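(* Let $K\to R$ be a homomorphism of commutative rings, and let $U$ and $V$ be two $R$-modules. Let $R\to S$ be a flat epimorphism of commutative rings and $D_R\colon U\to V$ be a $K$-linear quite $R$-differential operator of ordinal order $\alpha$. Then there exists a unique $K$-linear quite $S$-differential operator $D_S\colon\mathrm{Hom}_R(S,U)\to\mathrm{Hom}_R(S,V)$ such that $p_V\circ D_S=D_R\circ p_U$, where $p_U\colon\mathrm{Hom}_R(S,U)\to U$ and $p_V\colon\mathrm{Hom}_R(S,V)\to V$ are the natural maps $g\mapsto g(1)$. The ordinal order of the differential operator $D_S$ does not exceed $\alpha$.
   Context: For a homomorphism of commutative rings $K\to R$ and $R$-modules $U$, $V$, the group $E=\mathrm{Hom}_K(U,V)$ is an $R$-$R$-bimodule: $(re)(u)=r\,e(u)$, $(er)(u)=e(ru)$. Define by transfinite induction $F_0E=\{e\in E\mid re-er=0\ \forall r\in R\}$ and $F_\alpha E=\{e\in E\mid re-er\in\bigcup_{\beta<\alpha}F_\beta E\ \forall r\in R\}$ for every ordinal $\alpha>0$. A $K$-linear map $e\colon U\to V$ is a $K$-linear quite $R$-differential operator if $e\in F_\beta E$ for some ordinal $\beta$; its ordinal order is the smallest such $\beta$ if $e\ne0$ (the zero map is regarded as having order $-1$, smaller than all ordinals). So the ordinal order does not exceed $\alpha$ if and only if $e\in F_\alpha E$. The same definition with $S$ in place of $R$ (using the composition $K\to R\to S$) gives quite $S$-differential operators between $S$-modules. For an $R$-module $U$, $\mathrm{Hom}_R(S,U)$ is an $S$-module via $(sg)(t)=g(st)$.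 A flat epimorphism of commutative rings $R\to S$ is an epimorphism in the category of commutative rings such that $S$ is a flat $R$-module. *)

(* Defs.v *)
From HB Require Import structures.
From mathcomp Require Import all_boot all_algebra.
From mathcomp Require Import generic_quotient boolp.

Set Implicit Arguments.
Unset Strict Implicit.
Unset Printing Implicit Defensive.

Import GRing.Theory.
Local Open Scope ring_scope.
Local Open Scope quotient_scope.

(* A well-founded tree [Osup f] denotes the least ordinal strictly above all the
   ordinals denoted by the [f i].  Every ordinal is denoted by some tree, and two
   trees denote the same ordinal iff each is [ole] the other; no notion below
   distinguishes two such trees. *)
Inductive ord : Type := Osup (X : Type) (f : X -> ord).

Fixpoint ole (a b : ord) {struct a} : Prop :=
  let: Osup X f := a in let: Osup Y g := b in
  forall i : X, exists j : Y, ole (f i) (g j).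

Definition olt (a b : ord) : Prop :=
  let: Osup Y g := b in exists j : Y, ole a (g j).

Definition ozero : ord := Osup (of_void ord).

Lemma ole_sup X (f : X -> ord) b : ole (Osup f) b <-> forall i, olt (f i) b.
Proof. by case: b. Qed.

Lemma ole_refl a : ole a a.
Proof. by elim: a => X f IH /= i; exists i. Qed.

Lemma ole_trans b a c : ole a b -> ole b c -> ole a c.
Proof.
elim: a b c => X f IH [Y g] [Z h] /= fg gh i.
by have [j /IH fgj] := fg i; have [l /fgj] := gh j; exists l.
Qed.

Lemma olt_le_trans b a c : olt a b -> ole b c -> olt a c.
Proof.
case: b => Y g; case: c => Z h [j agj] /(_ j) [l gh].
by exists l; apply: ole_trans gh.
Qed.

Lemma ole_lt_trans b a c : ole a b -> olt b c -> olt a c.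
Proof. by case: c => Z h ab [l bh]; exists l; apply: ole_trans bh. Qed.

Lemma oltW a b : olt a b -> ole a b.
Proof.
elim: a b => X f IH [Y g] [j fg] i /=; exists j.
by apply: IH; case: (g j) fg => Z h; apply.
Qed.

Lemma olt_wf : well_founded olt.
Proof.
suff H b : forall a, ole a b -> Acc olt a by move=> a; apply: H (ole_refl a).
elim: b => Y g IH a ab; constructor=> c ca.
by have [j] := olt_le_trans ca ab; apply: IH.
Qed.

Lemma olt_irr a : ~ olt a a.
Proof. by elim/(well_founded_ind olt_wf): a => a IH aa; apply: (IH a aa). Qed.

Lemma ole_or_lt a b : ole a b \/ olt b a.
Proof.
elim: a b => X f IH b.
have [[i bf]|nbf] := pselect (exists i, ole b (f i)); first by right; exists i.
left; apply/ole_sup => i; case: b nbf => Y g nbf.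
apply: contrapT => nfg; apply: nbf; exists i; apply/ole_sup => j.
by have [fg|//] := IH i (g j); case: nfg; exists j.
Qed.

Lemma ole0 a : ole ozero a.
Proof. by case: a => X f []. Qed.

Definition restr (K R : comPzRingType) (f : {rmorphism K -> R})
  (M : lmodType R) : Type := M.

Section Restr.
Variables (K R : comPzRingType) (f : {rmorphism K -> R}) (M : lmodType R).
HB.instance Definition _ := GRing.Zmodule.on (restr f M).

Definition restr_scale (k : K) (m : restr f M) : restr f M := f k *: (m : M).

Fact restr_scaleA a b v :
  restr_scale a (restr_scale b v) = restr_scale (a * b) v.
Proof. by rewrite /restr_scale scalerA rmorphM. Qed.
Fact restr_scale1 : left_id 1 restr_scale.
Proof. by move=> v; rewrite /restr_scale rmorph1 scale1r. Qed.
Fact restr_scaleDr : right_distributive restr_scale +%R.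
Proof. by move=> a u v; rewrite /restr_scale scalerDr. Qed.
Fact restr_scaleDl v : {morph restr_scale^~ v : a b / a + b}.
Proof. by move=> a b; rewrite /restr_scale rmorphD scalerDl. Qed.

HB.instance Definition _ := GRing.Zmodule_isLmodule.Build K (restr f M)
  restr_scaleA restr_scale1 restr_scaleDr restr_scaleDl.

Lemma restr_scaleE (k : K) (m : restr f M) : k *: m = f k *: (m : M).
Proof. by []. Qed.
End Restr.

Definition lhom (R : comPzRingType) (M N : lmodType R) : Type :=
  {linear M -> N}.

Lemma lhomP (R : comPzRingType) (M N : lmodType R) (e e' : lhom M N) :
  e =1 e' <-> e = e'.
Proof.
split=> [|-> //]; case: e e' => [e ce] [e' ce'] /= /funext ee'.
case: e' / ee' ce' => ce'; congr GRing.Linear.Pack.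
case: ce ce' => [[a] [b]] [[a'] [b']].
by rewrite (Prop_irrelevance a a') (Prop_irrelevance b b').
Qed.

Section LhomZmod.
Variables (R : comPzRingType) (M N : lmodType R).
Implicit Types e : lhom M N.

HB.instance Definition _ := gen_eqMixin (lhom M N).
HB.instance Definition _ := gen_choiceMixin (lhom M N).

Definition lhom0 : lhom M N := \0 : {linear M -> N}.
Definition lhom_opp e : lhom M N := (\- e : {linear M -> N}).
Definition lhom_add e e' : lhom M N := (e \+ e' : {linear M -> N}).

Fact lhom_addA : associative lhom_add.
Proof. by move=> e1 e2 e3; apply/lhomP => m /=; rewrite addrA. Qed.
Fact lhom_addC : commutative lhom_add.
Proof. by move=> e1 e2; apply/lhomP => m /=; rewrite addrC. Qed.
Fact lhom_add0 : left_id lhom0 lhom_add.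
Proof. by move=> e; apply/lhomP => m /=; rewrite add0r. Qed.
Fact lhom_addN : left_inverse lhom0 lhom_opp lhom_add.
Proof. by move=> e; apply/lhomP => m /=; rewrite addNr. Qed.

HB.instance Definition _ := GRing.isZmodule.Build (lhom M N)
  lhom_addA lhom_addC lhom_add0 lhom_addN.
End LhomZmod.

Definition coind (R S : comPzRingType) (g : {rmorphism R -> S})
  (U : lmodType R) : Type := lhom (restr g S^o) U.

Section Coind.
Variables (R S : comPzRingType) (g : {rmorphism R -> S}) (U : lmodType R).
HB.instance Definition _ := GRing.Zmodule.on (coind g U).

Section Scale.
Variables (s : S) (h : coind g U).
Definition coind_scale_fun (t : restr g S^o) : U := h (s * (t : S)).
Fact coind_scale_linear : linear coind_scale_fun.
Proof.
move=> r t u; rewrite /coind_scale_fun -linearP; congr (h _).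
by rewrite mulrDr; congr (_ + _); rewrite mulrCA.
Qed.
HB.instance Definition _ := GRing.isLinear.Build R (restr g S^o) U *:%R
  coind_scale_fun coind_scale_linear.
Definition coind_scale : coind g U := coind_scale_fun : {linear _ -> _}.
End Scale.

Fact coind_scaleA a b h :
  coind_scale a (coind_scale b h) = coind_scale (a * b) h.
Proof.
by apply/lhomP => t; rewrite /= /coind_scale_fun /= /coind_scale_fun mulrCA mulrA.
Qed.
Fact coind_scale1 : left_id 1 coind_scale.
Proof. by move=> h; apply/lhomP => t; rewrite /= /coind_scale_fun mul1r. Qed.
Fact coind_scaleDr : right_distributive coind_scale +%R.
Proof. by move=> a h h'; apply/lhomP. Qed.
Fact coind_scaleDl h : {morph coind_scale^~ h : a b / a + b}.
Proof.
move=> a b; apply/lhomP => t.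
by rewrite /= /coind_scale_fun mulrDl; apply: linearD.
Qed.

HB.instance Definition _ := GRing.Zmodule_isLmodule.Build S (coind g U)
  coind_scaleA coind_scale1 coind_scaleDr coind_scaleDl.

Definition coind_ev1 (h : coind g U) : U := h (1 : S).

End Coind.

Section QuiteDiffOp.
Variables (K R : comPzRingType) (f : {rmorphism K -> R}) (U V : lmodType R).

Definition hom_over : Type := lhom (restr f U) (restr f V).
HB.instance Definition _ := GRing.Zmodule.on hom_over.

Section Actions.
Variables (r : R) (e : hom_over).

Definition lact_fun (u : restr f U) : restr f V := r *: (e u : V).
Definition ract_fun (u : restr f U) : restr f V := e (r *: (u : U)).

Fact lact_linear : linear lact_fun.
Proof.
move=> k u v; rewrite /lact_fun linearP scalerDr; congr (_ + _).
by rewrite !restr_scaleE !scalerA mulrC.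
Qed.
Fact ract_linear : linear ract_fun.
Proof.
move=> k u v; rewrite /ract_fun -linearP; congr (e _).
by rewrite scalerDr !restr_scaleE !scalerA mulrC.
Qed.

HB.instance Definition _ := GRing.isLinear.Build K (restr f U) (restr f V) *:%R
  lact_fun lact_linear.
HB.instance Definition _ := GRing.isLinear.Build K (restr f U) (restr f V) *:%R
  ract_fun ract_linear.

Definition lact : hom_over := lact_fun : {linear _ -> _}.
Definition ract : hom_over := ract_fun : {linear _ -> _}.
End Actions.

(* The transfinite recursion defining [F_a E], as an inductive predicate: since
   [olt] is well-founded, the two equations [filt_zero] and [filt_pos] below
   determine it. *)
Inductive filt (a : ord) (e : hom_over) : Prop :=
| Filt_zero of ~ olt ozero a & forall r, lact r e - ract r e = 0
| Filt_pos of olt ozero a &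
    forall r, exists b, olt b a /\ filt b (lact r e - ract r e).

Lemma filt_zero e : filt ozero e <-> forall r, lact r e - ract r e = 0.
Proof.
split=> [[_ //|/olt_irr //]|]; apply: Filt_zero; exact: olt_irr.
Qed.

Lemma filt_pos a e : olt ozero a ->
  filt a e <->
  forall r, exists b, olt b a /\ filt b (lact r e - ract r e).
Proof. by move=> a0; split=> [[]|]; last exact: Filt_pos. Qed.

Definition quite_diff_op (e : hom_over) : Prop := exists b, filt b e.

(* Ordinal orders: [None] is the order [-1] of the zero map. *)
Definition has_order (e : hom_over) (o : option ord) : Prop :=
  if o is Some a then e <> 0 /\ filt a e /\ (forall b, filt b e -> ole a b)
  else e = 0.

Lemma filt_le a b e : ole a b -> filt a e -> filt b e.
Proof.
have c0 : filt ozero 0.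
  apply/filt_zero => r; apply/lhomP => u.
  by rewrite /= /lact_fun /ract_fun /= scaler0 subr0.
have [b0|b0] := pselect (olt ozero b); last first.
  move=> ab [_ H|a0]; first exact: Filt_zero.
  by case: b0; apply: olt_le_trans ab.
move=> ab ae; apply: Filt_pos => // r.
case: ae => [_ ->|_ /(_ r) [c [ca ce]]]; first by exists ozero.
by exists c; split=> //; apply: olt_le_trans ab.
Qed.

(* This also makes the universe of [ord] large enough to index suprema by the
   elements of [hom_over]. *)
Lemma filt_exhaust : exists a, forall e, quite_diff_op e -> filt a e.
Proof.
have /choice [b bP] (e : hom_over) : exists b, quite_diff_op e -> filt b e.
  have [[b be]|nq] := pselect (quite_diff_op e); first by exists b.
  by exists ozero => /nq.
exists (Osup b) => e /bP; apply: filt_le; apply: oltW.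
by exists e; apply: ole_refl.
Qed.

End QuiteDiffOp.

Definition order_le (o o' : option ord) : Prop :=
  match o, o' with
  | None, _ => True
  | Some _, None => False
  | Some a, Some b => ole a b
  end.

Section Tensor.
Variable R : comPzRingType.

Definition is_bilinear (M N P : lmodType R) (b : M -> N -> P) : Prop :=
  (forall n, linear (b^~ n)) /\ (forall m, linear (b m)).

Definition is_tensor (M N T : lmodType R) (t : M -> N -> T) : Prop :=
  is_bilinear t /\
  forall (P : lmodType R) (b : M -> N -> P), is_bilinear b ->
    exists! h : {linear T -> P}, forall m n, h (t m n) = b m n.

Section TensorExists.
Variables M N : lmodType R.
Implicit Types l : seq (M * N).

Definition tens_eval (P : lmodType R) (b : M -> N -> P) l : P :=
  \sum_(x <- l) b x.1 x.2.

(* Two formal sums are identified in [M (x) N] when no bilinear map separates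
   them. *)
Definition tens_rel : rel (seq (M * N)) := fun l l' =>
  `[< forall (P : lmodType R) (b : M -> N -> P), is_bilinear b ->
      tens_eval b l = tens_eval b l' >].

Fact tens_rel_refl : reflexive tens_rel.
Proof. by move=> l; apply/asboolP. Qed.
Fact tens_rel_sym : symmetric tens_rel.
Proof. by move=> l l'; apply/asboolP/asboolP=> H P b /H. Qed.
Fact tens_rel_trans : transitive tens_rel.
Proof.
move=> l l1 l2 /asboolP H /asboolP H'; apply/asboolP => P b bb.
by rewrite H ?H'.
Qed.

Canonical tens_equiv := EquivRel tens_rel tens_rel_refl tens_rel_sym
  tens_rel_trans.
Definition tens := {eq_quot tens_equiv}.
HB.instance Definition _ := Choice.on tens.

Let mk l : tens := \pi_{eq_quot tens_equiv} l.
Let rep (x : tens) : seq (M * N) := repr (x : {eq_quot tens_equiv}).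
Let ev (P : lmodType R) (b : M -> N -> P) (x : tens) : P := tens_eval b (rep x).

Let evK (P : lmodType R) (b : M -> N -> P) l :
  is_bilinear b -> ev b (mk l) = tens_eval b l.
Proof.
move=> bb; have /eqmodP/asboolP : rep (mk l) = l %[mod {eq_quot tens_equiv}].
  exact: reprK.
exact.
Qed.

Let ev_ext (x y : tens) :
  (forall (P : lmodType R) (b : M -> N -> P), is_bilinear b ->
    ev b x = ev b y) -> x = y.
Proof.
move=> H; rewrite -[x](reprK (x : {eq_quot tens_equiv})).
rewrite -[y](reprK (y : {eq_quot tens_equiv})).
by apply/eqmodP/asboolP.
Qed.

Definition tens_add (x y : tens) : tens := mk (rep x ++ rep y).
Definition tens_scale (a : R) (x : tens) : tens :=
  mk [seq (a *: p.1, p.2) | p <- rep x].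

Let evD (P : lmodType R) (b : M -> N -> P) x y :
  is_bilinear b -> ev b (tens_add x y) = ev b x + ev b y.
Proof. by move=> bb; rewrite evK// /tens_eval big_cat. Qed.

Let ev0 (P : lmodType R) (b : M -> N -> P) : is_bilinear b -> ev b (mk [::]) = 0.
Proof. by move=> bb; rewrite evK// /tens_eval big_nil. Qed.

Let bilZ (P : lmodType R) (b : M -> N -> P) a m n :
  is_bilinear b -> b (a *: m) n = a *: b m n.
Proof.
case=> bl _.
pose bn := GRing.isLinear.Build R M P *:%R (b^~ n) (bl n).
pose h : {linear M -> P} := HB.pack (b^~ n) bn.
exact: (linearZ_LR h a m).
Qed.

Let evZ (P : lmodType R) (b : M -> N -> P) a x :
  is_bilinear b -> ev b (tens_scale a x) = a *: ev b x.
Proof.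
move=> bb; rewrite evK// /ev /tens_eval big_map scaler_sumr.
by apply: eq_bigr => p _; apply: bilZ.
Qed.

Fact tens_addA : associative tens_add.
Proof. by move=> x y z; apply: ev_ext => P b bb; rewrite !evD// addrA. Qed.
Fact tens_addC : commutative tens_add.
Proof. by move=> x y; apply: ev_ext => P b bb; rewrite !evD// addrC. Qed.
Fact tens_add0 : left_id (mk [::]) tens_add.
Proof. by move=> x; apply: ev_ext => P b bb; rewrite !evD// ev0// add0r. Qed.
Fact tens_addN : left_inverse (mk [::]) (tens_scale (- 1)) tens_add.
Proof.
by move=> x; apply: ev_ext => P b bb; rewrite evD// ev0// evZ// scaleN1r addNr.
Qed.
HB.instance Definition _ := GRing.isZmodule.Build tens
  tens_addA tens_addC tens_add0 tens_addN.

Fact tens_scaleA a b v : tens_scale a (tens_scale b v) = tens_scale (a * b) v.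
Proof. by apply: ev_ext => P c cb; rewrite !evZ// scalerA. Qed.
Fact tens_scale1 : left_id 1 tens_scale.
Proof. by move=> v; apply: ev_ext => P c cb; rewrite !evZ// scale1r. Qed.
Fact tens_scaleDr : right_distributive tens_scale +%R.
Proof.
by move=> a u v; apply: ev_ext => P c cb; rewrite evZ// !evD// !evZ// scalerDr.
Qed.
Fact tens_scaleDl v : {morph tens_scale^~ v : a b / a + b}.
Proof.
by move=> a b; apply: ev_ext => P c cb; rewrite evZ// evD// !evZ// scalerDl.
Qed.
HB.instance Definition _ := GRing.Zmodule_isLmodule.Build R tens
  tens_scaleA tens_scale1 tens_scaleDr tens_scaleDl.

Lemma tensor_exists : exists (T : lmodType R) (t : M -> N -> T), is_tensor t.
Proof.
have ev1 (P : lmodType R) (b : M -> N -> P) m n :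
    is_bilinear b -> ev b (mk [:: (m, n)]) = b m n.
  by move=> bb; rewrite evK// /tens_eval big_seq1.
exists tens, (fun m n => mk [:: (m, n)]); split.
  split=> [n a m m'|m a n n']; apply: ev_ext => P b bb;
    rewrite evD// evZ// !ev1//; case: bb => bl br; [exact: bl|exact: br].
move=> P b bb.
have evl : linear (ev b) by move=> a x y; rewrite evD// evZ.
pose h : {linear tens -> P} :=
  HB.pack (ev b) (GRing.isLinear.Build R tens P *:%R (ev b) evl).
exists h; split=> [m n|h' h'E]; first exact: ev1.
apply/lhomP => x; rewrite -[x](reprK (x : {eq_quot tens_equiv})).
rewrite -/(rep x) [LHS]evK//; elim: (rep x) => [|[m n] l IH].
  rewrite /tens_eval big_nil; exact: esym (linear0 h').
rewrite /tens_eval big_cons -/(tens_eval b l) IH -h'E -linearD; congr (h' _).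
apply: ev_ext => Q c cb; rewrite evD// ev1// !evK// /tens_eval big_cons//.
Qed.

End TensorExists.

(* [A (x) -] preserves injections, the tensor products being given by their
   universal property; they exist by [tensor_exists]. *)
Definition flat (A : lmodType R) : Prop :=
  forall (M N : lmodType R) (phi : {linear M -> N})
    (AM AN : lmodType R) (tM : A -> M -> AM) (tN : A -> N -> AN)
    (psi : {linear AM -> AN}),
  is_tensor tM -> is_tensor tN ->
  (forall a m, psi (tM a m) = tN a (phi m)) ->
  injective phi -> injective psi.

End Tensor.

Definition ring_epi (R S : comPzRingType) (g : {rmorphism R -> S}) : Prop :=
  forall (T : comPzRingType) (h h' : {rmorphism S -> T}),
    h \o g =1 h' \o g -> h =1 h'.

Definition flat_epi (R S : comPzRingType) (g : {rmorphism R -> S}) : Prop :=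
  ring_epi g /\ flat (restr g S^o).

(* Main.v *)
From HB Require Import structures.
Require Import Defs.
From mathcomp Require Import all_boot all_algebra.
From mathcomp Require Import generic_quotient boolp.

Set Implicit Arguments.
Unset Strict Implicit.
Unset Printing Implicit Defensive.

Import GRing.Theory.
Local Open Scope ring_scope.
Local Open Scope quotient_scope.

(* For an S-module M, let E = Hom_K(M, V), on which R acts on both sides and S
   on the right. The two actions of R agree on the successive quotients of the
   filtration F of E, so there the left one extends to S. Being an S-module is
   stable under extensions and unions among R-modules when R -> S is a flat
   epimorphism; hence every F_a E is a left S-module, with s e - e s of smaller
   order than e. For M = Hom_R(S, U) and e = D_R p_U, the lift is
   D_S m = (s |-> (s e) m), and [s, D_S] is the lift of s e - e s, which bounds
   its order by induction. Flat epimorphisms enter only through two facts: for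
   s in S the denominators {r | r s in the image of R} generate the unit ideal
   of S, and so does the annihilator of any k in the kernel of R -> S. *)

(** * Quotient modules, and annihilators of elements under flatness *)

Lemma quotient_lmodule (R : comPzRingType) (M : lmodType R) (P : M -> Prop) :
  P 0 -> (forall a x y, P x -> P y -> P (a *: x + y)) ->
  exists (Q : lmodType R) (p : {linear M -> Q}),
    (forall q, exists x, p x = q) /\ (forall x, p x = 0 <-> P x).
Proof.
move=> P0 Plin.
pose I0 : {pred M} := fun x => `[< P x >].
have I0P : zmod_closed I0.
  split=> [|x y /asboolP Px /asboolP Py]; apply/asboolP => //.
  by rewrite addrC -scaleN1r; apply: Plin.
pose I : zmodClosed M := HB.pack I0 (GRing.isZmodClosed.Build M I0 I0P).
pose Q := Quotient.quot I.
have piP (x y : M) : \pi_Q x = \pi_Q y <-> P (x - y).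
  split=> [/eqP|Pxy]; first by rewrite -Quotient.idealrBE => /asboolP.
  by apply/eqP; rewrite -Quotient.idealrBE; apply/asboolP.
have [sc scE] : exists sc : R -> Q -> Q,
    forall a x, sc a (\pi_Q x) = \pi_Q (a *: x).
  exists (fun a q => \pi_Q (a *: repr q)) => a x; apply/piP.
  rewrite -scalerBr -[_ *: _]addr0; apply: Plin => //.
  by apply/piP; rewrite reprK.
have piD x y : \pi_Q (x + y) = \pi_Q x + \pi_Q y by rewrite !piE.
have ax1 a b v : sc a (sc b v) = sc (a * b) v.
  by rewrite -[v]reprK !scE scalerA.
have ax2 : left_id 1 sc by move=> v; rewrite -[v]reprK scE scale1r.
have ax3 : right_distributive sc +%R.
  move=> a u v; rewrite -[u]reprK -[v]reprK.
  by rewrite -piD !scE scalerDr piD.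
have ax4 v : {morph sc^~ v : a b / a + b}.
  by move=> a b; rewrite -[v]reprK !scE scalerDl piD.
pose L : lmodType R :=
  HB.pack Q (GRing.Zmodule_isLmodule.Build R Q ax1 ax2 ax3 ax4).
have pl : linear (\pi_Q : M -> L) by move=> a x y; rewrite piD -scE.
pose p : {linear M -> L} :=
  HB.pack (\pi_Q : M -> L) (GRing.isLinear.Build R M L *:%R _ pl).
exists L, p; split=> [q|x]; first by exists (repr q); apply: reprK.
by rewrite -{2}[x]subr0 -piP /= raddf0.
Qed.

Lemma linear_fun_ex (R : comPzRingType) (M N : lmodType R) (h : M -> N) :
  linear h -> exists h' : {linear M -> N}, h' =1 h.
Proof.
move=> hl; pose h' : {linear M -> N} :=
  HB.pack h (GRing.isLinear.Build R M N *:%R h hl).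
by exists h'.
Qed.

Lemma linear_factor (R : comPzRingType) (M Q N : lmodType R)
    (p : {linear M -> Q}) (h : {linear M -> N}) :
  (forall q, exists x, p x = q) -> (forall x, p x = 0 -> h x = 0) ->
  exists h' : {linear Q -> N}, forall x, h' (p x) = h x.
Proof.
move=> /choice [s sK] ker.
have hs x : h (s (p x)) = h x.
  by apply/eqP; rewrite -subr_eq0 -linearB ker // linearB sK subrr.
have [h' h'E] : exists h' : {linear Q -> N}, h' =1 h \o s.
  apply: linear_fun_ex => a u v /=.
  by rewrite -(sK u) -(sK v) -linearP !hs linearP.
by exists h' => x; rewrite h'E /= hs.
Qed.

Lemma bilinearZ (R : comPzRingType) (M N P : lmodType R) (b : M -> N -> P)
    a m n :
  is_bilinear b -> b (a *: m) n = a *: b m n /\ b m (a *: n) = a *: b m n.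
Proof.
case=> bl br; have [h hE] := linear_fun_ex (bl n).
by have [k kE] := linear_fun_ex (br m); rewrite -hE -!kE !linearZ /= hE kE.
Qed.

(* Tensoring the injection [R / Ann m -> M], [1 |-> m], with [A] gives an
   injection [A / (Ann m) A -> A (x) M], [a |-> a (x) m]. *)
Lemma flat_annihilator (R : comPzRingType) (A M : lmodType R) (a : A) (m : M) :
  flat A ->
  (forall (P : lmodType R) (b : A -> M -> P), is_bilinear b -> b a m = 0) ->
  exists l : seq (R * A),
    (forall x, x \in l -> x.1 *: m = 0) /\ a = \sum_(x <- l) x.1 *: x.2.
Proof.
move=> flatA am0.
pose I (r : R^o) := r *: m = 0.
pose IA (x : A) := exists l : seq (R * A),
  (forall y, y \in l -> y.1 *: m = 0) /\ x = \sum_(y <- l) y.1 *: y.2.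
have [C [p [p_surj pE]]] : exists (C : lmodType R) (p : {linear R^o -> C}),
    (forall q, exists x, p x = q) /\ (forall x, p x = 0 <-> I x).
  apply: quotient_lmodule => [|c x y]; rewrite /I ?scale0r // => x0 y0.
  by rewrite scalerDl -scalerA x0 y0 scaler0 addr0.
have [D [q [_ qE]]] : exists (D : lmodType R) (q : {linear A -> D}),
    (forall d, exists x, q x = d) /\ (forall x, q x = 0 <-> IA x).
  apply: quotient_lmodule => [|c x y [l [lm ->]] [l' [lm' ->]]].
    by exists [::]; split=> [x|]; rewrite ?big_nil.
  exists ([seq (z.1, c *: z.2) | z <- l] ++ l'); split=> [z|].
    by rewrite mem_cat => /orP[/mapP[w /lm wm ->]|/lm'].
  rewrite big_cat big_map scaler_sumr; congr (_ + _).
  by apply: eq_bigr => z _; rewrite /= !scalerA mulrC.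
apply/qE.
have [phi phiE] : exists phi : {linear C -> M}, forall r, phi (p r) = r *: m.
  have [h hE] : exists h : {linear R^o -> M}, h =1 (fun r => r *: m).
    by apply: linear_fun_ex => c x y; rewrite scalerDl scalerA.
  have [|phi phiE] := linear_factor p_surj (h := h).
    by move=> x /pE; rewrite hE.
  by exists phi => r; rewrite phiE hE.
have phi_inj : injective phi.
  move=> x y /eqP; rewrite -subr_eq0 -linearB.
  have [r rE] := p_surj (x - y); rewrite -rE phiE => /eqP /pE.
  by rewrite rE => /eqP; rewrite subr_eq0 => /eqP.
have [AC [tC tCP]] := tensor_exists A C.
have [AM [tM tMP]] := tensor_exists A M.
have [psi [psiE _]] : exists! psi : {linear AC -> AM},
    forall x c, psi (tC x c) = tM x (phi c).
  apply: tCP.2; split=> [c|x]; first exact: tMP.1.1.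
  by move=> k u v; rewrite linearP tMP.1.2.
have psi_inj : injective psi := flatA _ _ phi _ _ _ _ psi tCP tMP psiE phi_inj.
have /choice [s sK] := p_surj.
have qs x r : q (s (p r) *: x) = q (r *: x).
  apply/eqP; rewrite -subr_eq0 -linearB -scalerBl; apply/eqP/qE.
  exists [:: (s (p r) - r, x)]; split=> [y|]; last by rewrite big_seq1.
  by rewrite inE => /eqP->; apply/pE; rewrite linearB /= sK subrr.
(* This is the map from A (x) R/I to A/IA, with I the annihilator of m: two lifts to R of a class in
   R/I differ by an element of I, so the section [s] induces a bilinear map. *)
have [e [eE _]] : exists! e : {linear AC -> D},
    forall x c, e (tC x c) = q (s c *: x).
  apply: tCP.2; split=> [c|x] k u v.
    by rewrite -linearP scalerDr !scalerA mulrC.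
  rewrite -{1}(sK u) -{1}(sK v) -linearP qs scalerDl linearD; congr (_ + _).
  by rewrite -scalerA linearZ.
have tC0 : tC a (p 1) = 0.
  apply: psi_inj; rewrite psiE phiE scale1r linear0.
  exact: am0 tMP.1.
by move: (eE a (p 1)); rewrite tC0 linear0 qs scale1r.
Qed.

(** * The commutative ring S (x)_R S *)

Section SelfTensor.
Variables (R S : comPzRingType) (g : {rmorphism R -> S}).
Local Notation A := (restr g S^o).

(** A separate name for S (x)_R S lets it carry a ring structure besides its module structure.
    Identities in it are tested against all bilinear maps. *)
Definition self_tens : Type := tens A A.
HB.instance Definition _ := GRing.Zmodule.on self_tens.

Let cls (l : seq (S * S)) : self_tens :=
  \pi_{eq_quot tens_equiv A A} (l : seq (A * A)).
Let rep (x : self_tens) : seq (S * S) := repr (x : {eq_quot tens_equiv A A}).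

Section Eval.
Variables (P : lmodType R) (b : S -> S -> P).
Hypothesis bb : is_bilinear (b : A -> A -> P).
Let ev (x : self_tens) : P := \sum_(p <- rep x) b p.1 p.2.

Lemma self_tens_evK l : ev (cls l) = \sum_(p <- l) b p.1 p.2.
Proof.
have /eqmodP/asboolP : rep (cls l) = l %[mod {eq_quot tens_equiv A A}].
  exact: reprK.
by move=> /(_ P b bb).
Qed.

Lemma self_tens_evD x y : ev (x + y) = ev x + ev y.
Proof. by rewrite -[RHS]big_cat -[RHS]self_tens_evK. Qed.

Lemma bilinear_mul s t :
  is_bilinear ((fun u v => b (s * u) (t * v)) : A -> A -> P).
Proof.
split=> [v|u] k x y; rewrite mulrDr; [rewrite -bb.1|rewrite -bb.2];
  by rewrite /= mulrCA.
Qed.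

(** With one factor of a product fixed, evaluating the product is bilinear in the other factor,
    hence can be computed on any representative of it. *)
Lemma bilinear_mul_sum (l : seq (S * S)) :
  is_bilinear ((fun u v => \sum_(p <- l) b (u * p.1) (v * p.2)) : A -> A -> P).
Proof.
split=> [v|u] k x y; rewrite scaler_sumr -big_split; apply: eq_bigr => p _ /=.
  by rewrite ![_ * p.1]mulrC (bilinear_mul _ _).1.
by rewrite ![_ * p.2]mulrC (bilinear_mul _ _).2.
Qed.

End Eval.

Lemma self_tens_ext (x y : self_tens) :
  (forall (P : lmodType R) (b : S -> S -> P), is_bilinear (b : A -> A -> P) ->
    \sum_(p <- rep x) b p.1 p.2 = \sum_(p <- rep y) b p.1 p.2) -> x = y.
Proof.
move=> H; rewrite -[x](reprK (x : {eq_quot tens_equiv A A})).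
rewrite -[y](reprK (y : {eq_quot tens_equiv A A})).
by apply/eqmodP/asboolP => P b /H.
Qed.

Let mul (x y : self_tens) : self_tens :=
  cls [seq (p.1 * q.1, p.2 * q.2) | p <- rep x, q <- rep y].

Let ev_mul (P : lmodType R) (b : S -> S -> P) (x y : self_tens) :
  is_bilinear (b : A -> A -> P) ->
  \sum_(p <- rep (mul x y)) b p.1 p.2 =
  \sum_(p <- rep x) \sum_(q <- rep y) b (p.1 * q.1) (p.2 * q.2).
Proof. by move=> bb; rewrite self_tens_evK // big_allpairs_dep. Qed.

Fact self_tens_mulC : commutative mul.
Proof.
move=> x y; apply: self_tens_ext => P b bb; rewrite !ev_mul // exchange_big.
by do 2![apply: eq_bigr => ? _]; congr (b _ _); rewrite mulrC.
Qed.

Fact self_tens_mulA : associative mul.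
Proof.
move=> x y z; apply: self_tens_ext => P b bb.
(* Commuting the outer product puts a nested product in first position on both sides, where
   [bilinear_mul_sum] applies. *)
rewrite [mul x _]self_tens_mulC !ev_mul //.
have bs l := bilinear_mul_sum bb l.
rewrite (self_tens_evK (bs (rep x))) (self_tens_evK (bs (rep z))).
rewrite !big_allpairs_dep.
rewrite [RHS]exchange_big; apply: eq_bigr => p _.
rewrite exchange_big; apply: eq_bigr => r _; apply: eq_bigr => q _ /=.
by congr (b _ _); rewrite mulrC mulrA.
Qed.

Fact self_tens_mul1 : left_id (cls [:: (1, 1)]) mul.
Proof.
move=> x; apply: self_tens_ext => P b bb; rewrite ev_mul //.
rewrite (self_tens_evK (bilinear_mul_sum bb (rep x))) big_seq1.
by apply: eq_bigr => p _; rewrite !mul1r.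
Qed.

Fact self_tens_mulDl : left_distributive mul +%R.
Proof.
move=> x y z; apply: self_tens_ext => P b bb.
rewrite self_tens_evD // !ev_mul //.
exact: (self_tens_evD (bilinear_mul_sum bb (rep z))).
Qed.

HB.instance Definition _ := GRing.Zmodule_isComPzRing.Build self_tens
  self_tens_mulA self_tens_mulC self_tens_mul1 self_tens_mulDl.

(* The ring maps [s |-> s (x) 1] and [s |-> 1 (x) s] agree on [R]. *)
Lemma ring_epi_bilinear (P : lmodType R) (b : S -> S -> P) (s : S) :
  ring_epi g -> is_bilinear (b : A -> A -> P) -> b s 1 = b 1 s.
Proof.
move=> epi bb.
pose i1 (x : S) := cls [:: (x, 1)]; pose i2 (x : S) := cls [:: (1, x)].
have i1Z : zmod_morphism i1.
  move=> x y; apply/eqP; rewrite eq_sym subr_eq; apply/eqP.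
  apply: self_tens_ext => Q c cb.
  rewrite self_tens_evD // !self_tens_evK // !big_seq1 /=.
  by have /= := cb.1 1 1 (x - y) y; rewrite !scale1r subrK.
have i2Z : zmod_morphism i2.
  move=> x y; apply/eqP; rewrite eq_sym subr_eq; apply/eqP.
  apply: self_tens_ext => Q c cb.
  rewrite self_tens_evD // !self_tens_evK // !big_seq1 /=.
  by have /= := cb.2 1 1 (x - y) y; rewrite !scale1r subrK.
have iM x1 x2 y1 y2 : cls [:: (x1, x2)] * cls [:: (y1, y2)] =
    cls [:: (x1 * y1, x2 * y2)].
  apply: self_tens_ext => Q c cb; rewrite ev_mul //.
  rewrite (self_tens_evK (bilinear_mul_sum cb _)) big_seq1.
  rewrite (self_tens_evK (bilinear_mul cb _ _)) big_seq1.
  by rewrite self_tens_evK // big_seq1.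
have i1M : monoid_morphism i1.
  by split=> // x y; rewrite [RHS]iM mul1r.
have i2M : monoid_morphism i2.
  by split=> // x y; rewrite [RHS]iM mul1r.
pose h1 : {rmorphism S -> self_tens} := HB.pack i1
  (GRing.isZmodMorphism.Build S self_tens i1 i1Z)
  (GRing.isMonoidMorphism.Build S self_tens i1 i1M).
pose h2 : {rmorphism S -> self_tens} := HB.pack i2
  (GRing.isZmodMorphism.Build S self_tens i2 i2Z)
  (GRing.isMonoidMorphism.Build S self_tens i2 i2M).
have /(_ s) h12 : h1 =1 h2.
  apply: epi => r; apply: self_tens_ext => Q c cb.
  rewrite !self_tens_evK // !big_seq1 /=.
  have [+ _] := bilinearZ r (1 : A) (1 : A) cb.
  have [_ +] := bilinearZ r (1 : A) (1 : A) cb.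
  by rewrite /= !restr_scaleE /GRing.scale /= !mulr1 => -> ->.
have := self_tens_evK bb [:: (s, 1)].
by rewrite -[cls _]/(h1 s) h12 self_tens_evK // !big_seq1.
Qed.

End SelfTensor.

(** * Ideals of R that generate the unit ideal of S *)

Section Covers.
Variables (R S : comPzRingType) (g : {rmorphism R -> S}).

(* For an ideal [P] of [R], this says that [P S = S]. *)
Definition covers (P : R -> Prop) : Prop :=
  exists l : seq (R * S),
    (forall x, x \in l -> P x.1) /\ \sum_(x <- l) g x.1 * x.2 = 1.

(** Multiply the two expressions of 1: a product of an element of [P] and one of [Q] satisfies
    both. *)
Lemma coversI (P Q : R -> Prop) :
  (forall a r, P r -> P (a * r)) -> (forall a r, Q r -> Q (a * r)) ->
  covers P -> covers Q -> covers (fun r => P r /\ Q r).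
Proof.
move=> PM QM [l [lP l1]] [l' [lQ l1']].
exists [seq (x.1 * y.1, x.2 * y.2) | x <- l, y <- l']; split=> [x|].
  case/allpairsP=> -[y z] /= [/lP yP /lQ zQ ->] /=.
  by split; [rewrite mulrC; apply: PM|apply: QM].
rewrite big_allpairs_dep /= -[RHS]mulr1 -{1}l1 -l1' mulr_suml.
apply: eq_bigr => x _; rewrite mulr_sumr.
by apply: eq_bigr => y _; rewrite rmorphM mulrACA.
Qed.

Lemma covers_scale_eq0 (P : R -> Prop) (M : lmodType S) (m : M) :
  covers P -> (forall r, P r -> g r *: m = 0) -> m = 0.
Proof.
case=> l [lP l1] Pm; rewrite -[m]scale1r -l1 scaler_suml big_seq.
by apply: big1 => x /lP /Pm xm; rewrite mulrC -scalerA xm scaler0.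
Qed.

Hypothesis g_flat_epi : flat_epi g.

(** The hypothesis means 1 (x) m = 0 in S (x) M, so [flat_annihilator] with A = S and a = 1 puts 1
    in Ann(m) S. *)
Lemma flat_epi_annihilator (M : lmodType R) (m : M) :
  (forall (P : lmodType R) (b : restr g S^o -> M -> P), is_bilinear b ->
    b (1 : S) m = 0) ->
  covers (fun r => r *: m = 0).
Proof.
move=> m0; have [l [lm l1]] := flat_annihilator g_flat_epi.2 m0.
by exists l; split.
Qed.

(** In S (x) R one has 1 (x) k = g(k) (x) 1 = 0. *)
Lemma covers_ker k : g k = 0 -> covers (fun r => r * k = 0).
Proof.
move=> k0; apply: (@flat_epi_annihilator R^o) => P b bb.
have [+ _] := @bilinearZ R (restr g S^o) R^o P b k (1 : S) 1 bb.
have [_ +] := @bilinearZ R (restr g S^o) R^o P b k (1 : S) 1 bb.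
rewrite restr_scaleE /GRing.scale /= mulr1 k0 => -> <-.
rewrite mul0r; have [h hE] := linear_fun_ex (bb.1 (1 : R^o)).
by rewrite -hE linear0.
Qed.

(** Let p : S -> S/g(R) be the projection. Since s (x) 1 = 1 (x) s in S (x) S, also 1 (x) p(s) = s
    (x) p(1) = 0, and the annihilator of p(s) consists of the denominators of s. *)
Lemma covers_denominators s : covers (fun r => exists r', g r * s = g r').
Proof.
have [M [p [_ pE]]] : exists (M : lmodType R) (p : {linear restr g S^o -> M}),
    (forall q, exists x, p x = q) /\
    (forall x, p x = 0 <-> exists r, x = g r :> S).
  apply: quotient_lmodule => [|a _ _ [r ->] [r' ->]].
    by exists 0; rewrite rmorph0.
  by exists (a * r + r'); rewrite rmorphD rmorphM.
have [l [lp l1]] : covers (fun r => r *: p s = 0).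
  apply: flat_epi_annihilator => P b bb.
  have bpb : is_bilinear (fun x y : restr g S^o => b x (p y)).
    by split=> [y|x] k u v; rewrite ?linearP ?bb.1 ?bb.2.
  rewrite -(ring_epi_bilinear s g_flat_epi.1 bpb).
  have /pE -> : exists r, 1 = g r :> S by exists 1; rewrite rmorph1.
  by have [h hE] := linear_fun_ex (bb.2 (s : S)); rewrite -hE linear0.
exists l; split=> // x /lp; rewrite -linearZ => /pE [r rE].
by exists r; rewrite -rE.
Qed.

Lemma covers_common_denominators (l : seq S) :
  covers (fun r => forall s, s \in l -> exists r', g r * s = g r').
Proof.
elim: l => [|s l IH].
  by exists [:: (1, 1)]; rewrite big_seq1 rmorph1 mulr1.
have M t a r : (exists r', g r * t = g r') -> exists r', g (a * r) * t = g r'.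
  by case=> r' E; exists (a * r'); rewrite !rmorphM -E mulrA.
have [||k [kP k1]] := coversI _ _ (covers_denominators s) IH.
- exact: M.
- by move=> a r H t /H; apply: M.
exists k; split=> // x /kP [xs xl] t; rewrite inE.
by case/orP=> [/eqP->|/xl].
Qed.

End Covers.

(** * General properties of the filtration F *)

Section Filtration.
Variables (K R : comPzRingType) (f : {rmorphism K -> R}).

Definition commut (U V : lmodType R) (r : R) (e : hom_over f U V) :=
  lact r e - ract r e.

(** The union of the F_b for b < a, with 0 added so that it is {0} rather than empty for a = 0. This
    merges the two clauses defining [filt] into the single criterion [filtP]. *)
Definition filt_lt (U V : lmodType R) (a : ord) (e : hom_over f U V) : Prop :=
  e = 0 \/ exists b, olt b a /\ filt b e.

Lemma commutE (U V : lmodType R) r (e : hom_over f U V) (u : U) :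
  commut r e u = r *: (e u : V) - e (r *: u).
Proof. by []. Qed.

Lemma commut0 (U V : lmodType R) r : commut r (0 : hom_over f U V) = 0.
Proof. by apply/lhomP => u; rewrite commutE /= scaler0 subr0. Qed.

Lemma commutD (U V : lmodType R) r (e e' : hom_over f U V) :
  commut r (e + e') = commut r e + commut r e'.
Proof.
apply/lhomP => u; rewrite commutE /= /lact_fun /ract_fun /=.
by rewrite scalerDr opprD addrACA.
Qed.

Lemma filtP (U V : lmodType R) a (e : hom_over f U V) :
  filt a e <-> forall r, filt_lt a (commut r e).
Proof.
split=> [[_ e0 r|_ er r]|er]; [by left; apply: e0|by right; apply: er|].
have [a0|a0] := pselect (olt ozero a).
  apply: Filt_pos => // r; rewrite -/(commut r e).
  case: (er r) => [->|//]; exists ozero; split=> //.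
  by apply/filt_zero => s; apply: commut0.
apply: Filt_zero => // r; case: (er r) => [//|[b [ba _]]].
by case: a0; apply: ole_lt_trans (ole0 b) ba.
Qed.

Lemma filt0 (U V : lmodType R) a : filt a (0 : hom_over f U V).
Proof. by apply/filtP => r; left; apply: commut0. Qed.

Lemma filt_ltW (U V : lmodType R) a (e : hom_over f U V) :
  filt_lt a e -> filt a e.
Proof. by case=> [->|[b [/oltW ba]]]; [apply: filt0|apply: filt_le]. Qed.

(** Ordinals are totally ordered, so both summands lie in one F_b. Additivity below [a] is a
    hypothesis here so that the lemma can serve in the induction for [filtD]. *)
Let filt_ltD_ind (U V : lmodType R) a (e e' : hom_over f U V) :
  (forall b, olt b a -> forall d d' : hom_over f U V,
    filt b d -> filt b d' -> filt b (d + d')) ->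
  filt_lt a e -> filt_lt a e' -> filt_lt a (e + e').
Proof.
move=> IH; case=> [->|[b [ba eb]]]; first by rewrite add0r.
case=> [->|[c [ca ec]]]; first by rewrite addr0; right; exists b.
right; have [bc|/oltW cb] := ole_or_lt b c.
  by exists c; split=> //; apply: IH => //; apply: filt_le eb.
by exists b; split=> //; apply: IH => //; apply: filt_le ec.
Qed.

Lemma filtD (U V : lmodType R) a (e e' : hom_over f U V) :
  filt a e -> filt a e' -> filt a (e + e').
Proof.
elim/(well_founded_ind olt_wf): a e e' => a IH e e' /filtP ea /filtP e'a.
by apply/filtP => r; rewrite commutD; apply: filt_ltD_ind.
Qed.

Lemma filt_ltD (U V : lmodType R) a (e e' : hom_over f U V) :
  filt_lt a e -> filt_lt a e' -> filt_lt a (e + e').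
Proof. by apply: filt_ltD_ind => b _; apply: filtD. Qed.

(** The filtration is defined by brackets alone. The lemma is applied to opposites, to left and
    right multiplications and to composition with p_U. *)
Lemma filt_map (U V U' V' : lmodType R) (h : hom_over f U V -> hom_over f U' V')
    a e :
  h 0 = 0 -> (forall r e', h (commut r e') = commut r (h e')) ->
  filt a e -> filt a (h e).
Proof.
move=> h0 hc; elim/(well_founded_ind olt_wf): a e => a IH e /filtP ea.
apply/filtP => r; rewrite -hc.
case: (ea r) => [->|[b [ba /(IH b ba) eb]]]; first by left.
by right; exists b.
Qed.

Lemma filt_lt_map (U V U' V' : lmodType R)
    (h : hom_over f U V -> hom_over f U' V') a e :
  h 0 = 0 -> (forall r e', h (commut r e') = commut r (h e')) ->
  filt_lt a e -> filt_lt a (h e).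
Proof.
move=> h0 hc [->|[b [ba eb]]]; first by left.
by right; exists b; split=> //; apply: filt_map.
Qed.

Lemma lact_commut (U V : lmodType R) r s (e : hom_over f U V) :
  lact s (commut r e) = commut r (lact s e).
Proof.
apply/lhomP => u; rewrite commutE /= /lact_fun commutE scalerBr.
by rewrite !scalerA mulrC.
Qed.

Lemma lact0 (U V : lmodType R) r : lact r (0 : hom_over f U V) = 0.
Proof. by apply/lhomP => u; rewrite /= /lact_fun scaler0. Qed.

Lemma oppr_commut (U V : lmodType R) r (e : hom_over f U V) :
  - commut r e = commut r (- e).
Proof.
apply/lhomP => u; rewrite commutE /= /lact_fun /ract_fun /=.
by rewrite opprB scalerN opprK addrC.
Qed.

Lemma filt_lact (U V : lmodType R) a r (e : hom_over f U V) :
  filt a e -> filt a (lact r e).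
Proof. by apply: filt_map; [apply: lact0|move=> s e'; apply: lact_commut]. Qed.

Lemma filtN (U V : lmodType R) a (e : hom_over f U V) :
  filt a e -> filt a (- e).
Proof. by apply: filt_map; [apply: oppr0|move=> s e'; apply: oppr_commut]. Qed.

Lemma filt_ltN (U V : lmodType R) a (e : hom_over f U V) :
  filt_lt a e -> filt_lt a (- e).
Proof. by apply: filt_lt_map; [apply: oppr0|move=> s e'; apply: oppr_commut]. Qed.

(** Well-foundedness provides a least [b] with e in F_b. *)
Lemma has_order_le (U V : lmodType R) a (e : hom_over f U V) :
  filt a e -> exists o, has_order e o /\ order_le o (Some a).
Proof.
move=> ea; have [e0|e0] := pselect (e = 0); first by exists None.
elim/(well_founded_ind olt_wf): a ea => a IH ea.
have [[b [ba eb]]|nb] := pselect (exists b, olt b a /\ filt b e).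
  have [[c|] [cP cb]] := IH b ba eb; last by [].
  by exists (Some c); split=> //; apply: ole_trans cb (oltW ba).
exists (Some a); split; last exact: ole_refl.
split=> //; split=> // b eb; have [//|ba] := ole_or_lt a b.
by case: nb; exists b.
Qed.

Lemma quiteD (U V : lmodType R) (e e' : hom_over f U V) :
  quite_diff_op e -> quite_diff_op e' -> quite_diff_op (e + e').
Proof.
move=> [a ea] [b eb]; have [h|/oltW h] := ole_or_lt a b.
  by exists b; apply: filtD => //; apply: filt_le ea.
by exists a; apply: filtD => //; apply: filt_le eb.
Qed.

Lemma quiteN (U V : lmodType R) (e : hom_over f U V) :
  quite_diff_op e -> quite_diff_op (- e).
Proof. by case=> a /filtN; exists a. Qed.

Lemma quite_lact (U V : lmodType R) r (e : hom_over f U V) :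
  quite_diff_op e -> quite_diff_op (lact r e).
Proof. by case=> a /(filt_lact r); exists a. Qed.

End Filtration.

(** * Left multiples by S of operators M -> V, and lifts to operators M -> Hom_R(S, V) *)

Lemma coind_ev1Z (R S : comPzRingType) (g : {rmorphism R -> S})
    (U : lmodType R) r (h : coind g U) :
  coind_ev1 (g r *: h) = r *: coind_ev1 h.
Proof. exact: (linearZ_LR (h : {linear restr g S^o -> U}) r (1 : S)). Qed.

Section FlatEpi.
Variables (K R S : comPzRingType) (f : {rmorphism K -> R}).
Variable g : {rmorphism R -> S}.
Hypothesis g_flat_epi : flat_epi g.

Section PartialAction.
Variables (M : lmodType S) (V : lmodType R).
Local Notation E := (hom_over f (restr g M) V).
Implicit Types e : E.

Section RightAction.
Variables (s : S) (e : E).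

Definition sact_fun (m : restr f (restr g M)) : restr f V := e (s *: (m : M)).

Fact sact_linear : linear sact_fun.
Proof.
move=> k u v; rewrite /sact_fun -linearP; congr (e _).
by rewrite scalerDr !restr_scaleE !scalerA mulrC.
Qed.

HB.instance Definition _ := GRing.isLinear.Build K (restr f (restr g M))
  (restr f V) *:%R sact_fun sact_linear.

Definition sact : E := sact_fun : {linear _ -> _}.
End RightAction.

Lemma sact0 s : sact s 0 = 0.
Proof. exact/lhomP. Qed.

Lemma sact_commut s r e : sact s (commut r e) = commut r (sact s e).
Proof.
apply/lhomP => m; rewrite commutE /= /sact_fun; congr (_ - e _).
by rewrite !restr_scaleE !scalerA mulrC.
Qed.

Lemma filt_sact a s e : filt a e -> filt a (sact s e).
Proof. by apply: filt_map; [apply: sact0|move=> r e'; apply: sact_commut]. Qed.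

Lemma filt_lt_sact a s e : filt_lt a e -> filt_lt a (sact s e).
Proof. by apply: filt_lt_map; [apply: sact0|move=> r e'; apply: sact_commut]. Qed.

(** Each [r, e] is again killed by [P], hence zero by induction, so e is R-linear. With 1 = \sum
    g(r_i) s_i and r_i in [P], this gives e(m) = \sum r_i e(s_i m) = 0. *)
Lemma filt_torsion_free (P : R -> Prop) a e :
  covers g P -> filt a e -> (forall r, P r -> forall m, r *: (e m : V) = 0) ->
  e = 0.
Proof.
move=> [l [lP l1]]; elim/(well_founded_ind olt_wf): a e => a IH e /filtP ea Pe.
have e0 r : commut r e = 0.
  case: (ea r) => [//|[b [ba eb]]]; apply: IH ba _ eb _ => t Pt m.
  by rewrite commutE scalerBr scalerA mulrC -scalerA !Pe // scaler0 subr0.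
apply/lhomP => m; rewrite -[m in LHS](scale1r (m : M)) -l1 scaler_suml.
rewrite (linear_sum e) big_seq; apply: big1 => x /lP /Pe xe.
have /lhomP /(_ (x.2 *: (m : M))) := e0 x.1.
by rewrite commutE xe sub0r -scalerA => /eqP; rewrite oppr_eq0 => /eqP.
Qed.

(** The map (r - r') e is killed by the annihilator of r - r', which generates the unit ideal of S
    because r - r' is in the kernel of g. *)
Lemma filt_ker_scale r r' a e (m : M) :
  g r = g r' -> filt a e -> r *: (e m : V) = r' *: (e m : V).
Proof.
move=> grr' ea; apply/eqP; rewrite -subr_eq0 -scalerBl; apply/eqP.
have k0 : g (r - r') = 0 by rewrite rmorphB /= grr' subrr.
have /lhomP/(_ m) : lact (r - r') e = 0; last by [].
apply: (filt_torsion_free (covers_ker g_flat_epi k0) (filt_lact _ ea)).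
by move=> t tk n; rewrite scalerA tk scale0r.
Qed.

(* [smul s e e'] says that [e'] is the left multiple of [e] by [s]: since the
   denominators [r] of [s] generate the unit ideal of [S], it determines [e']. *)
Definition smul (s : S) e e' : Prop :=
  forall r r', g r * s = g r' ->
  forall m, r *: (e' m : V) = r' *: (e m : V).

Lemma smul_uniq s e e1 e2 :
  quite_diff_op e1 -> quite_diff_op e2 -> smul s e e1 -> smul s e e2 -> e1 = e2.
Proof.
move=> q1 q2 s1 s2; apply/eqP; rewrite -subr_eq0; apply/eqP.
have [a ea] := quiteD q1 (quiteN q2).
apply: filt_torsion_free (covers_denominators g_flat_epi s) ea _.
move=> r [r' rr'] m.
by rewrite [_ - _]/= scalerBr (s1 _ _ rr') (s2 _ _ rr') subrr.
Qed.

Lemma filt_sum_lt a (I : eqType) (l : seq I) (d : I -> E) :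
  (forall x, x \in l -> filt_lt a (d x)) -> filt_lt a (\sum_(x <- l) d x).
Proof.
move=> dl; rewrite big_seq; apply: (big_ind (filt_lt a)); first by left.
  by move=> e e'; apply: filt_ltD.
exact: dl.
Qed.

Lemma hom_sumE (I : Type) (l : seq I) (d : I -> E) (m : M) :
  (\sum_(x <- l) d x) m = \sum_(x <- l) (d x m : V).
Proof. by apply: (big_morph (fun e : E => e m : V)). Qed.

(* Choose [1 = \sum s_i r_i] with [r_i s = r'_i]. The map
   [c r r' = r (e s) - r' e = [r, e] s - [r', e]] has smaller order than [e], so
   [s e := e s - \sum s_i (c r_i r'_i)] makes sense by induction; it works
   because [r (c r_i r'_i) = r_i (c r r')]. *)
Lemma smul_ex a s e :
  filt a e -> exists e', smul s e e' /\ filt_lt a (e' - sact s e).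
Proof.
elim/(well_founded_ind olt_wf): a s e => a IH s e ea.
have [l [lP l1]] := covers_denominators g_flat_epi s.
pose c r r' : E := sact s (commut r e) - commut r' e.
have cE r r' (m : M) : g r * s = g r' ->
    c r r' m = r *: (e (s *: m) : V) - r' *: (e m : V).
  move=> rr'; rewrite -[LHS]/(commut r e (s *: m) - commut r' e m) !commutE.
  rewrite !restr_scaleE !scalerA rr'.
  by rewrite opprB addrA subrK.
have c_lt r r' : filt_lt a (c r r').
  have /filtP ea' := ea.
  by apply: filt_ltD; [apply: filt_lt_sact|apply: filt_ltN].
have cC r r' t t' m : g r * s = g r' -> g t * s = g t' ->
    r *: (c t t' m : V) = t *: (c r r' m : V).
  move=> rr' tt'; rewrite !cE // !scalerBr !scalerA mulrC; congr (_ - _).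
  by apply: filt_ker_scale ea; rewrite !rmorphM /= -rr' -tt' mulrCA.
(* For (r_i, s_i) in [l], [d] is the left multiple s_i (c r_i r'_i), provided by the induction
   hypothesis unless c r_i r'_i = 0. *)
have /choice [d dP] (x : R * S) : exists d : E, x \in l ->
    exists r', g x.1 * s = g r' /\ filt_lt a d /\ smul x.2 (c x.1 r') d.
  have [xl|xl] := boolP (x \in l); last by exists 0.
  have [r' rr'] := lP _ xl.
  case: (c_lt x.1 r') => [c0|[b [ba cb]]].
    exists 0 => _; exists r'; split=> //; split; first by left.
    by rewrite c0 => t t' _ m; rewrite !scaler0.
  have [d [sd d_lt]] := IH b ba x.2 _ cb.
  exists d => _; exists r'; split=> //; split=> //; right; exists b; split=> //.
  rewrite -[d](subrK (sact x.2 (c x.1 r'))).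
  by apply: filtD; [apply: filt_ltW|apply: filt_sact].
pose n0 : E := \sum_(x <- l) d x.
have n0_lt : filt_lt a n0.
  by apply: filt_sum_lt => x xl; have [r' [_ []]] := dP x xl.
exists (sact s e - n0); split; last first.
  by rewrite addrC addKr; apply: filt_ltN.
move=> r r' rr' m.
(* Since r (e s) = c r r' + r' e, the equation r (e s - n0) = r' e amounts to r n0 = c r r'. *)
suff /lhomP/(_ m) : lact r n0 - c r r' = 0.
  rewrite -[LHS]/(r *: (n0 m : V) - c r r' m) cE // => /eqP.
  rewrite subr_eq0 => /eqP n0E.
  rewrite -[(sact s e - n0 : E) m]/((e (s *: m) : V) - n0 m).
  by rewrite scalerBr n0E opprB addrC subrK.
have ec : filt a (lact r n0 - c r r').
  by apply: filtD; [apply/filt_lact/filt_ltW|apply/filtN/filt_ltW].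
(* It suffices to compare after multiplying by a common denominator t of the s_i. With t s_i = t'_i,
   t r n0 becomes \sum t'_i r_i (c r r'), and \sum t'_i r_i has the same image in S as t. *)
have cov := covers_common_denominators g_flat_epi [seq x.2 | x <- l].
apply: filt_torsion_free cov ec _ => t tl {}m.
have /choice [t' t'P] (x : R * S) : exists t', x \in l -> g t * x.2 = g t'.
  have [xl|xl] := boolP (x \in l); last by exists 0.
  by have [t' tt'] := tl x.2 (map_f _ xl); exists t'.
rewrite -[(lact r n0 - c r r' : E) m]/(r *: (n0 m : V) - c r r' m).
rewrite scalerBr hom_sumE !scaler_sumr; apply/eqP; rewrite subr_eq0; apply/eqP.
transitivity (\sum_(x <- l) (t' x * x.1) *: (c r r' m : V)).
  rewrite !big_seq; apply: eq_bigr => x xl; have [r'x [xr [_ sd]]] := dP x xl.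
  rewrite scalerA [t * r]mulrC -[LHS]scalerA (sd _ _ (t'P _ xl)).
  by rewrite scalerA [r * _]mulrC -[LHS]scalerA (cC _ _ _ _ _ rr' xr) scalerA.
rewrite -scaler_suml; apply: filt_ker_scale (filt_ltW (c_lt r r')).
rewrite rmorph_sum -[RHS]mulr1 -l1 mulr_sumr big_seq [RHS]big_seq.
by apply: eq_bigr => x xl; rewrite rmorphM /= -(t'P _ xl) -mulrA [x.2 * _]mulrC.
Qed.

Lemma quite_sact s e : quite_diff_op e -> quite_diff_op (sact s e).
Proof. by case=> a /(filt_sact s); exists a. Qed.

Lemma quite_smul_ex s e :
  quite_diff_op e -> exists e', quite_diff_op e' /\ smul s e e'.
Proof.
move=> [a ea]; have [e' [se' /filt_ltW e'a]] := smul_ex s ea.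
exists e'; split=> //; exists a; rewrite -[e'](subrK (sact s e)).
by apply: filtD => //; apply: filt_sact.
Qed.

Lemma smul_lact r s e e' : smul s e e' -> smul (g r * s) e (lact r e').
Proof.
move=> se t t' tt' m; rewrite /= /lact_fun scalerA.
by apply: se; rewrite rmorphM -mulrA.
Qed.

(** After multiplication by a common denominator of s and t, both sides of the required equation are
    multiples of e by elements of R with the same image in S. *)
Lemma smulD s t e e1 e2 :
  quite_diff_op e -> quite_diff_op e1 -> quite_diff_op e2 ->
  smul s e e1 -> smul t e e2 -> smul (s + t) e (e1 + e2).
Proof.
move=> qe q1 q2 se te r r' rr' m.
have [a ea] : quite_diff_op (lact r (e1 + e2) - lact r' e).
  by apply: quiteD; [apply/quite_lact/quiteD|apply/quiteN/quite_lact].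
have cov := covers_common_denominators g_flat_epi [:: s; t].
suff /lhomP/(_ m) : lact r (e1 + e2) - lact r' e = 0.
  by move/eqP; rewrite [_ m]/= /lact_fun subr_eq0 => /eqP.
apply: filt_torsion_free cov ea _ => x xst {}m.
have [x1 xs] := xst s (mem_head _ _).
have [x2 xt] := xst t (mem_last _ [:: t]).
rewrite -[(_ : E) m]/(r *: ((e1 m : V) + (e2 m : V)) - r' *: (e m : V)).
rewrite !(scalerBr, scalerDr) !scalerA ![x * _]mulrC -!scalerA.
rewrite (se _ _ xs) (te _ _ xt) !scalerA -scalerDl -mulrDr.
have [b eb] := qe; apply/eqP; rewrite subr_eq0; apply/eqP.
apply: filt_ker_scale eb.
by rewrite !(rmorphM, rmorphD) /= -xs -xt -rr' -mulrDr [g x * _]mulrC mulrA.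
Qed.

(** That is, D m is the function s |-> (s e) m; the left multiple s e is quantified because [smul]
    is a relation. *)
Definition is_lift e (D : hom_over (g \o f)%FUN M (coind g V)) : Prop :=
  forall s, exists e', quite_diff_op e' /\ smul s e e' /\
    forall m : M, (D m : coind g V) s = e' m.

Lemma is_lift_ev1 e D (m : M) :
  quite_diff_op e -> is_lift e D -> coind_ev1 (D m) = e m.
Proof.
move=> qe /(_ 1) [e' [qe' [se' De']]]; rewrite /coind_ev1 De'.
have -> // : e' = e.
apply: (smul_uniq qe' qe se') => r r' rr' n.
by have [a ea] := qe; apply: filt_ker_scale ea; rewrite -rr' mulr1.
Qed.

Lemma is_lift0 D : is_lift 0 D -> D = 0.
Proof.
move=> D0; apply/lhomP => m; apply/lhomP => s.
have [e' [qe' [se' ->]]] := D0 s.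
have -> // : e' = 0.
apply: smul_uniq qe' _ se' _ => [|r r' _ n]; last by rewrite !scaler0.
by exists ozero; apply: filt0.
Qed.

(** Uniqueness of left multiples makes s |-> s e additive and R-linear, so s |-> (s e) m lies in
    Hom_R(S, V). *)
Lemma is_lift_ex e : quite_diff_op e -> exists D, is_lift e D.
Proof.
move=> qe; have /choice [F FP] s := quite_smul_ex s qe.
have FD s t : F (s + t) = F s + F t.
  have [[qs ss] [qt st]] := (FP s, FP t).
  exact: smul_uniq (FP _).1 (quiteD qs qt) (FP _).2 (smulD qe qs qt ss st).
have FZ r s : F (g r * s) = lact r (F s).
  apply: smul_uniq (FP _).1 _ (FP _).2 _; first exact: quite_lact (FP _).1.
  exact: smul_lact (FP _).2.
have /choice [L LE] (m : M) : exists h : coind g V, forall s, h s = F s m.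
  apply: linear_fun_ex => r s t.
  by rewrite [_ *: _]/(_ * _) FD FZ.
have Ll : linear (L : restr (g \o f)%FUN M -> restr (g \o f)%FUN (coind g V)).
  move=> k u v; apply/lhomP => s.
  by rewrite LE linearP /= /coind_scale_fun !LE /= FZ.
have [D DE] := linear_fun_ex Ll.
exists D => s; have [qs sms] := FP s; exists (F s); split=> //; split=> // m.
by rewrite DE LE.
Qed.

(** At t, [s, D] m takes the value ((s t) e) m - (t e)(s m), which is the left multiple of s e - e s
    by t, applied to m. *)
Lemma is_lift_commut s e e' D :
  quite_diff_op e' -> smul s e e' -> is_lift e D ->
  is_lift (e' - sact s e) (commut s D).
Proof.
move=> qe' se De t.
have [e2 [q2 [s2 D2]]] := De (s * t); have [e3 [q3 [s3 D3]]] := De t.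
exists (e2 - sact s e3); split.
  by apply/quiteD => //; apply/quiteN/quite_sact.
split=> [r r' rr' m|m].
  have se' := @smul_lact r' _ _ _ se.
  have sr' : g r * (s * t) = g r' * s by rewrite mulrCA rr' mulrC.
  rewrite -sr' in se'.
  (* With r t = r' in S, both r ((s t) e) and r' (s e) are the left multiple of e by r' s. *)
  have e2e' :=
    smul_uniq (quite_lact r q2) (quite_lact r' qe') (smul_lact s2) se'.
  have /lhomP/(_ m) e2m := e2e'.
  rewrite -[(e2 - sact s e3 : E) m]/((e2 m : V) - e3 (s *: m)).
  rewrite -[(e' - sact s e : E) m]/((e' m : V) - e (s *: m)).
  by rewrite !scalerBr (s3 _ _ rr'); congr (_ - _).
rewrite -[(e2 - sact s e3 : E) m]/((e2 m : V) - e3 (s *: m)) -D2 -D3.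
by [].
Qed.

(** By [smul_ex], s e - e s has smaller order than e or is zero, and [s, D] is its lift. *)
Lemma filt_lift a e D : filt a e -> is_lift e D -> filt a D.
Proof.
elim/(well_founded_ind olt_wf): a e D => a IH e D ea De; apply/filtP => s.
have [e' [se' e'a]] := smul_ex s ea.
have qe' : quite_diff_op e'.
  exists a; rewrite -[e'](subrK (sact s e)).
  by apply: filtD; [apply: filt_ltW|apply: filt_sact].
have := is_lift_commut qe' se' De.
case: e'a => [->|[b [ba eb]]]; first by move/is_lift0; left.
by right; exists b; split=> //; apply: IH eb _.
Qed.

(* [p_V D = 0] gives [p_V [g r, D] = 0], hence by induction [D] is [R]-linear,
   hence [S]-linear since [g] is an epimorphism. *)
Lemma lift_uniq a (D : hom_over (g \o f)%FUN M (coind g V)) :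
  filt a D -> (forall m : M, coind_ev1 (D m) = 0) -> D = 0.
Proof.
elim/(well_founded_ind olt_wf): a D => a IH D /filtP aD D0.
have DR r (m : M) : g r *: (D m : coind g V) = D (g r *: m).
  suff /lhomP/(_ m)/eqP : commut (g r) D = 0.
    by rewrite commutE subr_eq0 => /eqP.
  case: (aD (g r)) => [//|[b [ba bD]]]; apply: IH ba _ bD _ => n.
  rewrite commutE.
  rewrite -[LHS]/(coind_ev1 (g r *: (D n : coind g V)) - coind_ev1 (D (g r *: n))).
  by rewrite coind_ev1Z !D0 scaler0 subrr.
(* For a denominator r of s with r s = r', both r (s D(m)) and r D(s m) equal D(r' m). *)
have DS s (m : M) : s *: (D m : coind g V) = D (s *: m).
  apply/eqP; rewrite -subr_eq0; apply/eqP.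
  apply: covers_scale_eq0 (covers_denominators g_flat_epi s) _ => r [r' rr'].
  by rewrite scalerBr scalerA rr' !DR scalerA rr' subrr.
apply/lhomP => m; apply/lhomP => s.
by have := D0 (s *: m); rewrite -DS /coind_ev1 /= /coind_scale_fun mulr1.
Qed.

End PartialAction.
End FlatEpi.

(** * The operator D_R p_U, and the theorem *)

Section PrecompEv1.
Variables (K R S : comPzRingType) (f : {rmorphism K -> R}).
Variables (g : {rmorphism R -> S}) (U V : lmodType R) (e : hom_over f U V).

Definition comp_ev1_fun (h : restr f (restr g (coind g U))) : restr f V :=
  e (coind_ev1 h).

Fact comp_ev1_linear : linear comp_ev1_fun.
Proof.
move=> k u v; rewrite /comp_ev1_fun -linearP; congr (e _).
rewrite -[LHS]/(coind_ev1 (g (f k) *: (u : coind g U)) + coind_ev1 v).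
by rewrite coind_ev1Z.
Qed.

HB.instance Definition _ := GRing.isLinear.Build K
  (restr f (restr g (coind g U))) (restr f V) *:%R comp_ev1_fun comp_ev1_linear.

Definition comp_ev1 : hom_over f (restr g (coind g U)) V :=
  comp_ev1_fun : {linear _ -> _}.
End PrecompEv1.

(** As p_U is R-linear, composition with it commutes with brackets. *)
Lemma filt_comp_ev1 (K R S : comPzRingType) (f : {rmorphism K -> R})
    (g : {rmorphism R -> S}) (U V : lmodType R) a (e : hom_over f U V) :
  filt a e -> filt a (comp_ev1 g e).
Proof.
apply: filt_map => [|r e']; first exact/lhomP.
apply/lhomP => h; rewrite commutE /= /comp_ev1_fun; congr (_ - e' _).
by rewrite -coind_ev1Z.
Qed.

Theorem proposition7p5 (K R S : comPzRingType) (f : {rmorphism K -> R})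
    (g : {rmorphism R -> S}) (U V : lmodType R) (alpha : option ord)
    (D_R : hom_over f U V) :
  flat_epi g ->
  quite_diff_op D_R ->
  has_order D_R alpha ->
  (exists! D_S : hom_over (g \o f)%FUN (coind g U) (coind g V),
     quite_diff_op D_S /\
     (forall h : coind g U, coind_ev1 (D_S h) = D_R (coind_ev1 h))) /\
  (forall D_S : hom_over (g \o f)%FUN (coind g U) (coind g V),
     quite_diff_op D_S ->
     (forall h : coind g U, coind_ev1 (D_S h) = D_R (coind_ev1 h)) ->
     exists beta : option ord, has_order D_S beta /\ order_le beta alpha).
Proof.
move=> gfe [a0 Da0] oD.
have uniq (D D' : hom_over (g \o f)%FUN (coind g U) (coind g V)) :
    quite_diff_op D -> quite_diff_op D' ->
    (forall h : coind g U, coind_ev1 (D h) = coind_ev1 (D' h)) -> D = D'.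
  move=> qD qD' DD'; apply/eqP; rewrite -subr_eq0; apply/eqP.
  have [a Da] := quiteD qD (quiteN qD').
  apply: (lift_uniq gfe Da) => h.
  by rewrite -[LHS]/(coind_ev1 (D h) - coind_ev1 (D' h)) DD' subrr.
have qe : quite_diff_op (comp_ev1 g D_R) by exists a0; apply: filt_comp_ev1.
have [D De] := is_lift_ex gfe qe.
have D1 h : coind_ev1 (D h) = D_R (coind_ev1 h) := is_lift_ev1 gfe h qe De.
(* This holds for every [a], so it applies both to the witness [a0] and to the exact order of
   [D_R]. *)
have Dfilt a : filt a D_R -> filt a D.
  by move=> Da; apply: (filt_lift gfe (filt_comp_ev1 g Da) De).
have qD : quite_diff_op D by exists a0; apply: Dfilt.
split.
  exists D; split=> // D' [qD' D'1]; by apply: uniq => // h; rewrite D1 D'1.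
move=> D' qD' D'1.
have -> : D' = D by apply: uniq => // h; rewrite D1 D'1.
case: alpha oD => [a [_ [/Dfilt Da _]]|DR0]; first exact: has_order_le.
(* If D_R = 0, the zero operator is also a lift, so uniqueness gives D = 0. *)
exists None; split=> //=; apply: uniq => //; first by exists a0; apply: filt0.
by move=> h; rewrite D1 [D_R]DR0.
Qed.
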